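(* Let $C$ be a field that is a finite algebraic extension of $\mathbb{Q}$. Let $A=C[x_1,x_2]$ be an integral domain generated as a $C$-algebra by two elements $x_1,x_2$ (not necessarily algebraically independent), equipped with a derivation $D$, such that the field of differential constants of the quotient field $E$ of $A$ is $C$. Then $A$ has a finitely generated extension $T$ with $A\subseteq T\subseteq E$ such that $T$ has no nonzero proper differential ideals.
   Context: The derivation $D$ of $A$ is extended to the quotient field $E$ by the quotient rule; the field of differential constants of $E$ is $\{w\in E: D(w)=0\}$. A differential ideal is an ideal $I$ with $D(I)\subseteq I$. A finitely generated extension of $A$ within $E$ means a subring $T$ of $E$ containing $A$, finitely generated as an $A$-algebra and closed under $D$. *)

(* Defs.v *)
From HB Require Import structures.
From mathcomp Require Export all_boot all_order all_algebra all_field.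
From mathcomp Require Export boolp classical_sets.
From mathcomp Require Import ring.

Set Implicit Arguments.
Unset Strict Implicit.
Unset Printing Implicit Defensive.

Import GRing.Theory.
Local Open Scope classical_set_scope.
Local Open Scope ring_scope.

Notation "x %:F" := (@FracField.tofrac _ x) : ring_scope.

Record is_derivation (A : pzRingType) (D : A -> A) : Prop := IsDerivation {
  derivation_add : {morph D : a b / a + b};
  derivation_mul : forall a b, D (a * b) = D a * b + a * D b
}.

(* The numerator and denominator are those of the canonical representative of
   w; [frac_deriv_quot] shows that any other representation gives the same
   value. *)
Definition frac_deriv (A : idomainType) (D : A -> A) (w : {fraction A}) :
    {fraction A} :=
  let n := \n_(repr w) in let d := \d_(repr w) in
  (D n * d - n * D d)%:F / (d ^+ 2)%:F.

Definition constants (R : nmodType) (D : R -> R) : set R := [set w | D w = 0].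

Definition is_subring (R : pzRingType) (S : set R) : Prop :=
  GRing.subring_closed [in S].

(* The B-subalgebra of R generated by G, where R is a B-algebra through f. *)
Definition algebra_gen (B R : pzRingType) (f : {rmorphism B -> R})
    (G : set R) : set R :=
  smallest (@is_subring R) (range f `|` G).

Record fg_diff_extension (A : idomainType) (D : A -> A)
    (T : set {fraction A}) : Prop := FgDiffExtension {
  extension_subring : is_subring T;
  extension_contains : range (@FracField.tofrac A) `<=` T;
  extension_fg :
    exists s : seq {fraction A}, T = algebra_gen (@FracField.tofrac A) [set` s];
  extension_diff : frac_deriv D @` T `<=` T
}.

(* I is a differential ideal of the subring T, both given as subsets of R. *)
Record is_diff_ideal (R : comPzRingType) (D : R -> R) (T I : set R) :
    Prop := IsDiffIdeal {
  diff_ideal_sub : I `<=` T;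
  diff_ideal_zmod : zmod_closed [in I];
  diff_ideal_mul : forall t x, T t -> I x -> I (t * x);
  diff_ideal_deriv : D @` I `<=` I
}.

Lemma frac_repr (A : idomainType) (w : {fraction A}) :
  w = (\n_(repr w))%:F / (\d_(repr w))%:F.
Proof.
rewrite -{1}[w]reprK; move: (repr w) => r; unlock FracField.tofrac.
have d0 := denom_ratioP r.
rewrite -[X in _ = _ * X]FracField.pi_inv -[RHS]FracField.pi_mul.
apply/eqmodP; rewrite /= FracField.equivfE /FracField.mulf /FracField.invf.
by rewrite !numden_Ratio ?(oner_neq0, mulr1, mul1r) // mulrC.
Qed.

Lemma frac_deriv_quot (A : idomainType) (D : A -> A) (a b : A) :
  is_derivation D -> b != 0 ->
  frac_deriv D (a%:F / b%:F) = (D a * b - a * D b)%:F / (b ^+ 2)%:F.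
Proof.
move=> [_ DM] b0; rewrite /frac_deriv.
set w := a%:F / b%:F; have := frac_repr w.
have := denom_ratioP (repr w).
set n := \n_(repr w); set d := \d_(repr w) => d0.
have F0 x : x != 0 -> x%:F != 0 :> {fraction A} by rewrite tofrac_eq0.
move/eqP; rewrite /w eqr_div ?F0 // -!tofracM tofrac_eq => /eqP adnb.
apply/eqP; rewrite eqr_div ?F0 ?expf_neq0 // -!tofracM tofrac_eq eq_sym.
rewrite -subr_eq0; apply/eqP.
have := congr1 D adnb; rewrite !DM => DE.
transitivity (b * d * ((D a * d + a * D d) - (D n * b + n * D b))
              - (b * D d + d * D b) * (a * d - n * b)); first by ring.
by rewrite DE adnb !subrr !mulr0 subrr.
Qed.

(* Main.v *)
Require Import Defs.
From mathcomp Require Import all_boot all_order all_algebra all_field.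
From mathcomp Require Import boolp classical_sets.
From mathcomp Require Import ring zify.

Set Implicit Arguments.
Unset Strict Implicit.
Unset Printing Implicit Defensive.

Import Order.TTheory GRing.Theory Num.Theory.
Local Open Scope classical_set_scope.
Local Open Scope ring_scope.

(** The ring T is a localization A[1/g].  A nonzero ideal of A[1/g] stable under
    the derivation restricts to a nonzero D-stable ideal J of A from which
    factors g can be cancelled, so it is enough to find one g such that every
    such J contains 1 ([localization_simple]).

    If D kills both generators, then D = 0, hence A is the field C and g = 1
    works.  Otherwise call x a generator with D x != 0 and y the other one, and
    let D x divide g.  Then J meets C[x] only in 0 or J contains 1: if p(x) lies
    in J then so does D (p(x)) = p'(x) D x, hence p'(x), and differentiating
    repeatedly ends at a nonzero constant ([meets_base_unit]).  In particular x
    is transcendental over C.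

    If y is algebraic over C(x), any nonzero element of A has a nonzero multiple
    in C[x], so J meets C[x] and g = D x works ([meets_base]).

    Otherwise A is the polynomial ring C[x][y].  The elements of A that have a
    nonzero C[x]-multiple in J form a D-stable ideal J'; dividing by an element
    f of J' of least degree in y, made primitive over C[x], shows by the lemma
    of Gauss that f divides D f ([darboux_in_ideal]).  So f is a Darboux
    polynomial: D f = l f with a cofactor l whose degrees are bounded in terms
    of D x and D y only ([cofactor_bound]).

    The cofactors therefore lie in a vector space of finite dimension over C,
    hence over Q because C is a number field.  Choose Darboux polynomials f_i
    whose cofactors span the same rational subspace as all cofactors.  The
    cofactor of an arbitrary Darboux polynomial f is a rational combination of
    those of the f_i.  Cofactors add when polynomials are multiplied, so after
    clearing denominators f ^ n times a product of the f_i, and another product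
    of the f_i, have the same cofactor; the quotient of the two is a constant of
    the fraction field, hence lies in C.  So every Darboux polynomial divides a
    power of G, the product of the f_i ([darboux_finite]).  With g = D x * G
    this makes f invertible, so J meets C[x] outside 0, whence J contains 1. *)

(** * Derivations, cofactors and differential ideals *)

Lemma exists_min (T : Type) (S : set T) (m : T -> nat) (x0 : T) :
  S x0 -> exists2 x, S x & forall y, S y -> (m x <= m y)%N.
Proof.
move=> Sx0; have ex : exists n, `[< exists2 x, S x & m x = n >].
  by exists (m x0); apply/asboolP; exists x0.
case: (ex_minnP ex) => n /asboolP[x Sx <-] min_x.
by exists x => // y Sy; apply: min_x; apply/asboolP; exists y.
Qed.

Section Derivations.
Variables (R : comPzRingType) (D : R -> R).
Hypothesis D_der : is_derivation D.

Lemma derivation0 : D 0 = 0.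
Proof. by apply: (addrI (D 0)); rewrite -(derivation_add D_der) !addr0. Qed.

Lemma derivation1 : D 1 = 0.
Proof.
apply: (addrI (D 1)).
by rewrite addr0 -[in RHS](mulr1 1) (derivation_mul D_der) mulr1 mul1r.
Qed.

Lemma cofactorM f l h m :
  D f = l * f -> D h = m * h -> D (f * h) = (l + m) * (f * h).
Proof. by move=> Df Dh; rewrite (derivation_mul D_der) Df Dh; ring. Qed.

Lemma cofactorX f l n : D f = l * f -> D (f ^+ n) = (l *+ n) * f ^+ n.
Proof.
move=> Df; elim: n => [|n IHn]; first by rewrite derivation1 mul0r.
by rewrite exprS mulrS; apply: cofactorM.
Qed.

End Derivations.

Section DifferentialIdeals.
Variables (R : comPzRingType) (D : R -> R) (T J : set R).
Hypothesis J_ideal : is_diff_ideal D T J.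

Lemma diff_ideal0 : J 0.
Proof. by case: (diff_ideal_zmod J_ideal); rewrite inE. Qed.

Lemma diff_idealB a b : J a -> J b -> J (a - b).
Proof.
case: (diff_ideal_zmod J_ideal) => _ JB Ja Jb.
by have := JB a b; rewrite !inE; apply.
Qed.

Lemma diff_ideal_der a : J a -> J (D a).
Proof. by move=> Ja; apply: (diff_ideal_deriv J_ideal); exists a. Qed.

End DifferentialIdeals.

Lemma full_diff_idealP (R : comPzRingType) (D : R -> R) (J : set R) :
  J 0 -> (forall a b, J a -> J b -> J (a - b)) ->
  (forall t a, J a -> J (t * a)) -> (forall a, J a -> J (D a)) ->
  is_diff_ideal D setT J.
Proof.
move=> J0 JB JM JD; split=> //.
- by split=> [|a b]; rewrite !inE //; apply: JB.
- by move=> t a _; apply: JM.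
- by move=> _ [a Ja <-]; apply: JD.
Qed.

(** Invertibility of g, seen from the ideals of the ring before localization. *)
Definition saturated (R : comPzRingType) (g : R) (J : set R) : Prop :=
  forall a, J (g * a) -> J a.

Lemma saturatedX (R : comPzRingType) (g : R) (J : set R) n :
  saturated g J -> saturated (g ^+ n) J.
Proof.
move=> sat; elim: n => [|n IHn] a; first by rewrite mul1r.
by rewrite exprS -mulrA => /sat/IHn.
Qed.

Lemma saturated_factor (R : comPzRingType) (D : R -> R) (g h : R) (J : set R) :
  is_diff_ideal D setT J -> saturated (g * h) J -> saturated g J.
Proof.
move=> J_ideal sat a Ja; apply: sat; rewrite [g * h]mulrC -mulrA.
exact: (diff_ideal_mul J_ideal).
Qed.

(** * Differential simplicity of localizations *)

Section Localization.
Variables (A : idomainType) (D : A -> A).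
Hypothesis D_der : is_derivation D.

Lemma frac_deriv_tofrac (a : A) : frac_deriv D a%:F = (D a)%:F.
Proof.
have := frac_deriv_quot a D_der (oner_neq0 A).
by rewrite (derivation1 D_der) expr1n tofrac1 !divr1 mulr1 mulr0 subr0.
Qed.

Definition localization (g : A) : set {fraction A} :=
  [set w | exists a n, w = a%:F / (g ^+ n)%:F].

Variable g : A.
Hypothesis g_neq0 : g != 0.

Let gF_neq0 n : (g ^+ n)%:F != 0 :> {fraction A}.
Proof. by rewrite tofrac_eq0 expf_neq0. Qed.

Lemma localization_subring : is_subring (localization g).
Proof.
split=> [|u v|u v]; rewrite !inE.
- by exists 1, 0%N; rewrite expr0 tofrac1 divr1.
- move=> [a [n ->]] [b [m ->]]; exists (a * g ^+ m - b * g ^+ n), (n + m)%N.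
  by rewrite exprD tofracB !tofracM -mulNr addf_div ?gF_neq0 // mulNr.
- move=> [a [n ->]] [b [m ->]]; exists (a * b), (n + m)%N.
  by rewrite exprD !tofracM mulf_div.
Qed.

Lemma localization_contains a : localization g a%:F.
Proof. by exists a, 0%N; rewrite expr0 tofrac1 divr1. Qed.

Lemma localization_gen :
  localization g =
    algebra_gen (@FracField.tofrac A) [set` [:: (g%:F)^-1]].
Proof.
apply/seteqP; split=> [_ [a [n ->]] S [[S1 SB SM] S_sub]|w].
  have SMm u v : S u -> S v -> S (u * v).
    by move=> Su Sv; have := SM u v; rewrite !inE; apply.
  apply: (SMm); first by apply: S_sub; left; exists a.
  elim: n => [|n IHn]; first by rewrite expr0 tofrac1 invr1 -inE.
  rewrite exprS tofracM invfM; apply: (SMm) => //.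
  by apply: S_sub; right; rewrite /= inE.
move=> w_gen; apply: (w_gen (localization g)).
split; first exact: localization_subring.
move=> v [[a _ <-]|/=]; first exact: localization_contains.
by rewrite inE => /eqP->; exists 1, 1%N; rewrite expr1 tofrac1 div1r.
Qed.

Lemma localization_extension : fg_diff_extension D (localization g).
Proof.
split.
- exact: localization_subring.
- by move=> _ [a _ <-]; apply: localization_contains.
- by exists [:: (g%:F)^-1]; apply: localization_gen.
- move=> _ [_ [a [n ->]] <-].
  rewrite frac_deriv_quot ?expf_neq0 // -exprM.
  by eexists; eexists.
Qed.

(** An ideal of the localization is recovered from its restriction J to A, which
    is stable under D because [frac_deriv D] extends D, and saturated because g
    is invertible. *)
Lemma localization_simple :
  (forall J : set A, is_diff_ideal D setT J -> saturated g J ->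
     (exists2 a, J a & a != 0) -> J 1) ->
  forall I : set {fraction A},
    is_diff_ideal (frac_deriv D) (localization g) I ->
    I = [set 0] \/ I = localization g.
Proof.
move=> simple I I_ideal.
have [I0|/existsNP[w /not_implyP[Iw /eqP w0]]] :=
    pselect (forall w, I w -> w = 0).
  left; apply/seteqP; split=> [w /I0 //|_ ->].
  exact: (diff_ideal0 I_ideal).
right; apply/seteqP; split=> [|t Tt]; first exact: (diff_ideal_sub I_ideal).
suff I1 : I 1 by rewrite -[t]mulr1; apply: (diff_ideal_mul I_ideal).
rewrite -tofrac1; apply: (simple [set a | I a%:F]).
- apply: full_diff_idealP => /= [|a b Ia Ib|b a Ia|a Ia].
  + by rewrite tofrac0; apply: (diff_ideal0 I_ideal).
  + by rewrite tofracB; apply: (diff_idealB I_ideal).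
  + rewrite tofracM; apply: (diff_ideal_mul I_ideal) => //.
    exact: localization_contains.
  + by rewrite -frac_deriv_tofrac; apply: (diff_ideal_der I_ideal).
- move=> a /= Iga; have -> : a%:F = (g%:F)^-1 * (g * a)%:F :> {fraction A}.
    by rewrite tofracM mulKf // tofrac_eq0.
  apply: (diff_ideal_mul I_ideal) => //.
  by exists 1, 1%N; rewrite expr1 tofrac1 div1r.
- have [a [n w_eq]] := diff_ideal_sub I_ideal Iw.
  exists a => /=; last first.
    by apply: contraNneq w0 => a0; rewrite w_eq a0 tofrac0 mul0r.
  have -> : a%:F = (g ^+ n)%:F * w by rewrite w_eq mulrC divfK.
  exact: (diff_ideal_mul I_ideal (localization_contains _) Iw).
Qed.

End Localization.

(** * Primitive polynomials and Darboux polynomials in differential ideals *)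

Section Gauss.
Variable K : fieldType.
Implicit Types (p q : {poly K}) (F G H : {poly {poly K}}).

Lemma dvd_coefP p F : (exists G, F = p *: G) <-> forall i, p %| F`_i.
Proof.
split=> [[G ->] i|p_dvd]; first by rewrite coefZ dvdp_mulr.
exists (\poly_(i < size F) (F`_i %/ p)); apply/polyP=> i.
rewrite coefZ coef_poly; case: ltnP => [_|/(nth_default 0) ->].
  by rewrite mulrC divpK.
by rewrite mulr0.
Qed.

(** A divisor of least size among those of positive degree is prime: its gcd with
    any u is again such a divisor, unless it is a unit. *)
Lemma exists_prime_factor p : (1 < size p)%N ->
  exists q, [/\ q %| p, (1 < size q)%N & forall u, q %| u \/ coprimep q u].
Proof.
move=> p_gt1.
have [q [q_dvd q_gt1] q_min] :=
  @exists_min _ [set q | q %| p /\ (1 < size q)%N] (fun q => size q) p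
    (conj (dvdpp p) p_gt1).
exists q; split=> // u; have q0 : q != 0 by rewrite -size_poly_gt0 ltnW.
have [|cop] := boolP (coprimep q u); [by right | left].
have d_gt1 : (1 < size (gcdp q u))%N.
  have d0 : gcdp q u != 0 by rewrite gcdp_eq0 negb_and q0.
  by move: cop d0; rewrite /coprimep -size_poly_gt0; lia.
have le_qd := q_min _ (conj (dvdp_trans (dvdp_gcdl q u) q_dvd) d_gt1).
have : gcdp q u %= q.
  rewrite -(dvdp_size_eqp (dvdp_gcdl q u)) eqn_leq le_qd andbT.
  exact: dvdp_leq (dvdp_gcdl q u).
by move/eqp_dvdl<-; apply: dvdp_gcdr.
Qed.

(** Gauss: if i and j are the least indices whose coefficients in F and G are not
    multiples of p, every term of the coefficient of index i + j of F * G is a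
    multiple of p, except F`_i * G`_j. *)
Lemma dvd_coef_prime p F G : (forall u, p %| u \/ coprimep p u) ->
  (forall i, p %| (F * G)`_i) ->
  (forall i, p %| F`_i) \/ (forall i, p %| G`_i).
Proof.
move=> p_prime dvdFG.
have [|/existsNP[i1 /negP Fi1]] := pselect (forall i, p %| F`_i).
  by left.
have [|/existsNP[j1 /negP Gj1]] := pselect (forall i, p %| G`_i).
  by right.
have exF : exists i, ~~ (p %| F`_i) by exists i1.
have exG : exists j, ~~ (p %| G`_j) by exists j1.
case: (ex_minnP exF) => i Fi minF; case: (ex_minnP exG) => j Gj minG.
have ij : (i < (i + j).+1)%N by lia.
have := dvdFG (i + j)%N; rewrite coefM (bigD1 (Ordinal ij)) //= addKn.
rewrite dvdp_addl => [|]; last first.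
  apply: (big_ind (fun u => p %| u)) => [|u v pu pv|k /eqP/val_eqP /= k_i].
  - exact: dvdp0.
  - by rewrite dvdp_add.
  have [lt_ki|le_ik] := ltnP k i.
    apply: dvdp_mulr; apply: contraLR lt_ki => pFk.
    by rewrite -leqNgt; apply: minF.
  apply: dvdp_mull; have lt_j : (i + j - k < j)%N by have := ltn_ord k; lia.
  by apply: contraLR lt_j => pGk; rewrite -leqNgt; apply: minG.
case: (p_prime F`_i) => [pFi|cop]; first by rewrite pFi in Fi.
by rewrite Gauss_dvdpr // => pGj; rewrite pGj in Gj.
Qed.

Definition primitive F := forall p G, F = p *: G -> (size p <= 1)%N.

(** The prime factors of p are cancelled one at a time: each divides G by
    [dvd_coef_prime], since it cannot divide F. *)
Lemma primitive_cancel F p G H : primitive F -> p != 0 ->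
  p *: H = G * F -> exists Q, H = Q * F.
Proof.
move=> F_prim; have [n] := ubnP (size p).
elim: n p G H => // n IHn p G H le_pn p0 pH_eq.
have [p_gt1|p_le1] := ltnP 1 (size p); last first.
  have /size_poly1P[c c0 p_eq] : size p == 1%N.
    by move: p0 p_le1; rewrite -size_poly_gt0; lia.
  exists (c^-1%:P *: G); rewrite -scalerAl -pH_eq scalerA p_eq -polyCM.
  by rewrite mulVf // polyC1 scale1r.
have [q [q_dvd q_gt1 q_prime]] := exists_prime_factor p_gt1.
have [r p_eq] : exists r : {poly K}, p = r * q by apply/dvdpP.
have q0 : q != 0 by rewrite -size_poly_gt0 ltnW.
have r0 : r != 0 by apply: contraNneq p0 => r0; rewrite p_eq r0 mul0r.
have : forall i, q %| (G * F)`_i.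
  by move=> i; rewrite -pH_eq coefZ p_eq -mulrA dvdp_mull // dvdp_mulr.
move/(dvd_coef_prime q_prime)=> [] /dvd_coefP[Q Q_eq]; last first.
  by have := F_prim _ _ Q_eq; lia.
apply: (IHn r Q) => //.
  have sz_p : size p = (size r + size q).-1 by rewrite p_eq size_mul.
  by have := size_poly_gt0 r; rewrite r0; lia.
have : q *: (r *: H) = q *: (Q * F).
  by rewrite scalerA [q * r]mulrC -p_eq pH_eq Q_eq -scalerAl.
by rewrite -!mul_polyC; apply: mulfI; rewrite polyC_eq0.
Qed.

(** Over the field K(x), J generates a principal ideal, with an element of least
    degree as generator; it divides its derivative since J is stable.  Choosing
    the leading coefficient of least degree too makes this generator primitive,
    because J is saturated, and the division then holds over K[x]. *)
Lemma darboux_in_ideal (D : {poly {poly K}} -> {poly {poly K}})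
    (J : set {poly {poly K}}) :
  is_diff_ideal D setT J -> (forall p, p != 0 -> saturated p%:P J) ->
  (exists2 h, J h & h != 0) -> exists f l, [/\ f != 0, J f & D f = l * f].
Proof.
move=> J_ideal J_sat [h Jh h0].
have [f1 [Jf1 f1_0] f1_min] :=
  @exists_min _ [set f | J f /\ f != 0] (fun f => size f) h (conj Jh h0).
have [f [Jf f0 sz_f] f_min] := @exists_min _
  [set f | [/\ J f, f != 0 & size f = size f1]] (fun f => size (lead_coef f)) f1
  (And3 Jf1 f1_0 (erefl _)).
have f_prim : primitive f.
  move=> p g f_eq; rewrite leqNgt; apply/negP => p_gt1.
  have p0 : p != 0 by rewrite -size_poly_gt0 ltnW.
  have g0 : g != 0 by apply: contraNneq f0 => g0; rewrite f_eq g0 scaler0.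
  have Jg : J g by apply: (J_sat _ p0); rewrite mul_polyC -f_eq.
  have szg : size g = size f1 by rewrite -sz_f f_eq size_scale.
  have := f_min _ (And3 Jg g0 szg).
  have -> : size (lead_coef f) = (size p + size (lead_coef g)).-1.
    by rewrite f_eq lead_coefZ size_mul ?lead_coef_eq0.
  have := size_poly_gt0 (lead_coef g); rewrite lead_coef_eq0 g0; lia.
have JDf : J (D f) := diff_ideal_der J_ideal Jf.
have eq_div := Pdiv.WeakIdomain.divp_eq (D f) f.
set c := lead_coef f ^+ _ in eq_div.
have c0 : c != 0 by rewrite expf_neq0 // lead_coef_eq0.
have Jr : J (D f %% f).
  have -> : D f %% f = c%:P * D f - (D f %/ f) * f.
    by rewrite mul_polyC eq_div addrC addKr.
  by apply: (diff_idealB J_ideal); apply: (diff_ideal_mul J_ideal).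
have r0 : D f %% f = 0.
  apply/eqP/negPn/negP => r0; have := f1_min _ (conj Jr r0).
  by rewrite -sz_f leqNgt Pdiv.Idomain.ltn_modp f0.
rewrite r0 addr0 in eq_div.
have [l Df] := primitive_cancel f_prim c0 eq_div.
by exists f, l.
Qed.

End Gauss.

(** * Planar derivations and the size of cofactors *)

Section PlanarDerivation.
Variable K : fieldType.
Implicit Types (F G a b f l : {poly {poly K}}).

(** The outer variable y of {poly {poly K}} is sent to b, and the inner variable x
    to a; exchanging the variables turns the partial derivative along x into the
    formal derivative. *)
Definition planar_deriv a b F : {poly {poly K}} :=
  a * swapXY (swapXY F)^`() + b * F^`().

Lemma planar_derivP a b : is_derivation (planar_deriv a b).
Proof.
split=> [F G|F G]; rewrite /planar_deriv.
  by rewrite !(rmorphD, derivD); ring.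
by rewrite rmorphM /= !derivM rmorphD !rmorphM /= !swapXYK; ring.
Qed.

Lemma planar_derivC a b (p : {poly K}) :
  planar_deriv a b p%:P = a * p^`()%:P.
Proof.
rewrite /planar_deriv derivC mulr0 addr0.
by rewrite swapXY_polyC deriv_map swapXY_map_polyC.
Qed.

Lemma planar_derivX a b : planar_deriv a b 'X = b.
Proof.
by rewrite /planar_deriv swapXY_X derivC rmorph0 mulr0 add0r derivX mulr1.
Qed.

Lemma sizeY_leP F n :
  reflect (forall i, (size (F`_i)%R <= n)%N) (sizeY F <= n)%N.
Proof.
apply: (iffP idP) => [le_n i|le_n].
  exact: leq_trans (max_size_coefXY F i) le_n.
by apply/bigmax_leqP => i _; apply: le_n.
Qed.

Lemma sizeY_deriv F : (sizeY F^`() <= sizeY F)%N.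
Proof.
apply/sizeY_leP => i; rewrite coef_deriv -scaler_nat.
exact: leq_trans (size_scale_leq _ _) (max_size_coefXY F i.+1).
Qed.

Lemma size_derivX F : (size (swapXY (swapXY F)^`()) <= size F)%N.
Proof.
rewrite -[F in leqRHS]swapXYK -!sizeYE; exact: sizeY_deriv.
Qed.

Lemma size_deriv_leq (R : nzRingType) (p : {poly R}) : (size p^`() <= size p)%N.
Proof.
have [->|/lt_size_deriv/ltnW//] := eqVneq p 0.
by rewrite derivC.
Qed.

Definition maxdeg a b : nat :=
  maxn (maxn (size a) (size b)) (maxn (sizeY a) (sizeY b)).

Lemma size_cofactor (R : idomainType) (a b f g h l : {poly R}) :
  f != 0 -> (size g <= size f)%N -> (size h <= size f)%N ->
  a * g + b * h = l * f -> (size l <= maxn (size a) (size b))%N.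
Proof.
move=> f0 le_g le_h lf_eq.
have [->|l0] := eqVneq l 0; first by rewrite size_poly0.
have := size_polyD (a * g) (b * h); rewrite lf_eq size_mul //.
have := size_polyMleq a g; have := size_polyMleq b h.
have := size_poly_gt0 f; rewrite f0.
by have := size_poly_gt0 l; rewrite l0; lia.
Qed.

(** A derivation raises each of the two degrees by an amount that depends only on
    a and b, and the degrees of a product add up. *)
Lemma cofactor_bound a b f l : f != 0 -> planar_deriv a b f = l * f ->
  (size l <= maxdeg a b)%N /\ (sizeY l <= maxdeg a b)%N.
Proof.
move=> f0 Df; split; rewrite leq_max; apply/orP; [left | right].
  exact: size_cofactor f0 (size_derivX f) (size_deriv_leq f) Df.
rewrite !sizeYE; have sf0 : swapXY f != 0 by rewrite swapXY_eq0.
apply: (size_cofactor sf0 (g := (swapXY f)^`()) (h := swapXY f^`())).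
- exact: size_deriv_leq.
- by rewrite -!sizeYE; exact: sizeY_deriv.
- by rewrite -[RHS]rmorphM -Df rmorphD !rmorphM /= swapXYK.
Qed.

Definition coefXY n F : {ffun 'I_n * 'I_n -> K} :=
  [ffun ij : 'I_n * 'I_n => F`_(ij.1)`_(ij.2)].

Lemma coefXY_inj n F G :
  (size F <= n)%N -> (sizeY F <= n)%N -> (size G <= n)%N -> (sizeY G <= n)%N ->
  coefXY n F = coefXY n G -> F = G.
Proof.
move=> sF /sizeY_leP sYF sG /sizeY_leP sYG eqFG.
apply/polyP => i; have [lt_in|le_ni] := ltnP i n; last first.
  by rewrite (nth_default _ (leq_trans sF le_ni))
             (nth_default _ (leq_trans sG le_ni)).
apply/polyP => j; have [lt_jn|le_nj] := ltnP j n; last first.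
  by rewrite (nth_default _ (leq_trans (sYF i) le_nj))
             (nth_default _ (leq_trans (sYG i) le_nj)).
have /ffunP/(_ (Ordinal lt_in, Ordinal lt_jn)) := eqFG.
by rewrite !ffunE.
Qed.

End PlanarDerivation.

(** A sequence in S whose span has the largest possible dimension. *)
Lemma span_subset (K : fieldType) (V : vectType K) (S : set V) :
  exists2 s : seq V, {in s, forall v, S v} & forall v, S v -> v \in <<s>>%VS.
Proof.
pose B := [set s : seq V | {in s, forall v, S v}].
have [s Bs s_max] := @exists_min _ B (fun s => \dim {:V} - \dim <<s>>)%N [::]
  (fun v => ltac:(by rewrite in_nil)).
exists s => // v Sv; apply/negPn/negP => v_notin.
have : (\dim <<s>> < \dim <<v :: s>>)%N.
  rewrite ltn_neqAle span_cons dimv_leqif_sup ?addvSr //=.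
  by rewrite subv_add subvv andbT -memvE (negPf v_notin) dimvS ?addvSr.
have Bvs : B (v :: s).
  by move=> u; rewrite inE => /orP[/eqP->|] //; apply: Bs.
have := s_max _ Bvs; have := dimvS (subvf <<v :: s>>%VS).
have := dimvS (subvf <<s>>%VS); lia.
Qed.

Section Darboux.
Variables (C : fieldExtType rat) (a b : {poly {poly C}}).
Let P := {poly {poly C}}.
Let D : P -> P := planar_deriv a b.
Let n := maxdeg a b.
Let V : vectType rat := {ffun 'I_n * 'I_n -> C}.
Let kappa : P -> V := @coefXY C n.

Let kappaD l m : kappa (l + m) = kappa l + kappa m.
Proof. by apply/ffunP=> ij; rewrite !ffunE !coefD. Qed.

Let kappaMn l k : kappa (l *+ k) = kappa l *+ k.
Proof.
elim: k => [|k IHk]; first by apply/ffunP=> ij; rewrite !ffunE !mulr0n !coef0.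
by rewrite !mulrS kappaD IHk.
Qed.

Let cofactor_vectors : set V :=
  [set v | exists f l, [/\ f != 0, D f = l * f & v = kappa l]].

Let D_der : is_derivation D := planar_derivP a b.

(** A rational relation v = \sum_i c_i v_i between cofactors, with denominators
    cleared and the negative terms moved to the left, becomes
    (k + 1) v + (cofactor of u) = (cofactor of w), where u and w are products of
    the corresponding polynomials; G is the product of all of them. *)
Lemma span_cofactors (s : seq V) : {in s, forall v, cofactor_vectors v} ->
  exists2 G : P, G != 0 & forall v, v \in <<s>>%VS ->
    exists k u w l m, [/\ u != 0, D u = l * u, D w = m * w,
      (exists e r, w * r = G ^+ e) & v *+ k.+1 + kappa l = kappa m].
Proof.
elim: s => [_|v0 s IHs s_cof].
  exists 1; first exact: oner_neq0.
  move=> v; rewrite span_nil memv0 => /eqP->.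
  exists 0%N, 1, 1, 0, 0; rewrite oner_neq0 (derivation1 D_der) mul0r.
  by split; rewrite ?mul0rn ?add0r //; exists 0%N, 1; rewrite mulr1.
have [|G0 G00 G0P] := IHs.
  by move=> v vs; apply: s_cof; rewrite inE vs orbT.
have [|f0 [l0 [f00 Df0 v0_eq]]] := s_cof v0; first by rewrite mem_head.
exists (f0 * G0) => [|v]; first by rewrite mulf_neq0.
rewrite span_cons => /memv_addP[_ /vlineP[c ->] [v' /G0P v's ->]].
have [k [u [w [l [m [u0 Du Dw [e [r wr]] v'_eq]]]]]] := v's.
have [d d_eq] : exists d, denq c = d.+1%:Z.
  by exists `|denq c|.-1%N; rewrite prednK ?absz_gt0 ?denq_neq0 // gtz0_abs.
(* With c = p / (d + 1), multiply the relation for v' by d + 1. *)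
set p := numq c.
have cv0 : (c *: v0) *+ d.+1 = v0 *~ p.
  rewrite -scaler_nat scalerA -[v0 *~ p]scaler_int; congr (_ *: _).
  by rewrite mulrC /p numqE d_eq.
have sum_eq : (c *: v0 + v') *+ (k.+1 * d.+1) + kappa (l *+ d.+1) =
    v0 *~ p *+ k.+1 + kappa (m *+ d.+1).
  have -> : (c *: v0 + v') *+ (k.+1 * d.+1) =
      v0 *~ p *+ k.+1 + v' *+ k.+1 *+ d.+1.
    by rewrite mulrnDl [in X in X + _]mulnC !mulrnA cv0.
  by rewrite !kappaMn -addrA -mulrnDl v'_eq.
exists (k.+1 * d.+1).-1; rewrite prednK //.
have divG j : exists e1 r1, f0 ^+ j * w ^+ d.+1 * r1 = (f0 * G0) ^+ e1.
  exists (j + e * d.+1)%N, (r ^+ d.+1 * f0 ^+ (e * d.+1) * G0 ^+ j).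
  transitivity (f0 ^+ (j + e * d.+1) * ((w * r) ^+ d.+1 * G0 ^+ j)).
    by rewrite exprD exprMn; ring.
  by rewrite wr -exprM exprMn -exprD [(e * _ + j)%N]addnC.
(* The power of f0 goes to the side where its exponent is nonnegative. *)
have [j [p_eq|p_eq]] : exists j : nat, p = j%:Z \/ p = - j%:Z.
- by exists `|p|%N; lia.
- exists (u ^+ d.+1), (f0 ^+ (j * k.+1) * w ^+ d.+1).
  exists (l *+ d.+1), (l0 *+ (j * k.+1) + m *+ d.+1); split.
  + by rewrite expf_neq0.
  + exact: cofactorX.
  + by apply: cofactorM => //; apply: cofactorX.
  + exact: divG.
  + by rewrite sum_eq p_eq kappaD !kappaMn -v0_eq mulrnA.
- exists (f0 ^+ (j * k.+1) * u ^+ d.+1), (w ^+ d.+1).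
  exists (l0 *+ (j * k.+1) + l *+ d.+1), (m *+ d.+1); split.
  + by rewrite mulf_neq0 ?expf_neq0.
  + by apply: cofactorM => //; apply: cofactorX.
  + exact: cofactorX.
  + by have := divG 0%N; rewrite expr0 mul1r.
  + rewrite kappaD addrCA sum_eq p_eq !kappaMn -v0_eq mulrNz mulNrn.
    by rewrite -pmulrn mulrnA addrA subrr add0r.
Qed.

(** Two Darboux polynomials with the same cofactor have a rational first integral
    as quotient, hence the hypothesis.  It applies to f ^ (k + 1) * u and w, where
    u and w come from [span_cofactors], and w divides a power of G. *)
Lemma darboux_finite :
  (forall u w l : P, u != 0 -> w != 0 -> D u = l * u -> D w = l * w ->
     exists c : C, u = c%:P%:P * w) ->
  exists2 G : P, G != 0 & forall f l, f != 0 -> D f = l * f ->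
    exists e r, f * r = G ^+ e.
Proof.
move=> const; have [s s_cof s_span] := span_subset cofactor_vectors.
have [G G0 GP] := span_cofactors s_cof; exists G => // f l f0 Df.
have /s_span/GP[k [u [w [lu [lw [u0 Du Dw [e [r wr]] eq_k]]]]]] :
  cofactor_vectors (kappa l) by exists f, l.
have w0 : w != 0.
  by have := expf_neq0 e G0; rewrite -wr mulf_eq0 negb_or => /andP[].
have fu0 : f ^+ k.+1 * u != 0 by rewrite mulf_neq0 ?expf_neq0.
have Dfu := cofactorM D_der (cofactorX D_der k.+1 Df) Du.
have lw_eq : l *+ k.+1 + lu = lw.
  have [s1 t1] := cofactor_bound fu0 Dfu.
  have [s2 t2] := cofactor_bound w0 Dw.
  by apply: (coefXY_inj s1 t1 s2 t2); rewrite -/kappa kappaD kappaMn.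
rewrite lw_eq in Dfu; have [c fu_eq] := const _ _ _ fu0 w0 Dfu Dw.
have c0 : c != 0 by apply: contraNneq fu0 => c0; rewrite fu_eq c0 !polyC0 mul0r.
exists e, (c^-1%:P%:P * f ^+ k * u * r).
have cc : c^-1%:P%:P * c%:P%:P = 1 :> P by rewrite -!polyCM mulVf.
transitivity (c^-1%:P%:P * (f ^+ k.+1 * u) * r); first by rewrite exprS; ring.
by rewrite fu_eq mulrA cc mul1r wr.
Qed.

End Darboux.

(** * Two-generated differential algebras *)

Lemma deriv_neq0 (C : fieldExtType rat) (p : {poly C}) :
  (1 < size p)%N -> p^`() != 0.
Proof.
move=> p_gt1; apply/eqP => /polyP/(_ (size p).-2).
rewrite coef_deriv coef0 prednK; last by lia.
apply/eqP; rewrite -mulr_natr mulf_neq0 //.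
  by rewrite -lead_coefE lead_coef_eq0 -size_poly_gt0 ltnW.
have /pcharf0P -> : [pchar C] =i pred0.
  by move=> q; rewrite (pchar_lalg C) pchar_num.
by lia.
Qed.

Section TwoGenerators.
Variables (C : fieldExtType rat) (A : idomainType) (iota : {rmorphism C -> A}).
Variables (x y : A) (D : A -> A).
Hypothesis A_gen : algebra_gen iota [set x; y] = setT.
Hypothesis D_der : is_derivation D.
Hypothesis E_const :
  constants (frac_deriv D) = range (fun c : C => (iota c)%:F).

(** The quotient u / w has derivative zero, so it lies in C. *)
Lemma wronskian_const (u w : A) : w != 0 -> D u * w - u * D w = 0 ->
  exists c : C, u = iota c * w.
Proof.
move=> w0 wr0; have : constants (frac_deriv D) (u%:F / w%:F).
  by rewrite /constants /= frac_deriv_quot // wr0 tofrac0 mul0r.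
rewrite E_const => -[c _ uw_eq].
exists c; apply/eqP; rewrite -tofrac_eq tofracM uw_eq divfK //.
by rewrite tofrac_eq0.
Qed.

Lemma deriv_iota c : D (iota c) = 0.
Proof.
have : range (fun c : C => (iota c)%:F) (iota c)%:F by exists c.
rewrite -E_const /constants /= frac_deriv_tofrac //.
by move/eqP; rewrite tofrac_eq0 => /eqP.
Qed.

Definition evalx : {rmorphism {poly C} -> A} :=
  horner_morph (fun c => mulrC x (iota c) : GRing.comm x (iota c)).
Definition eval : {rmorphism {poly {poly C}} -> A} :=
  horner_morph (fun p => mulrC y (evalx p) : GRing.comm y (evalx p)).

Lemma evalxX : evalx 'X = x. Proof. exact: horner_morphX. Qed.
Lemma evalxC c : evalx c%:P = iota c. Proof. exact: horner_morphC. Qed.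
Lemma evalX : eval 'X = y. Proof. exact: horner_morphX. Qed.
Lemma evalC p : eval p%:P = evalx p. Proof. exact: horner_morphC. Qed.

Lemma eval_surj (t : A) : exists F, t = eval F.
Proof.
suff : algebra_gen iota [set x; y] `<=` range eval.
  by rewrite A_gen => /(_ t I)[F _ <-]; exists F.
move=> v gen_v; apply: (gen_v (range eval)); split=> [|w].
  split=> [|v1 v2|v1 v2]; rewrite !inE.
  - by exists 1; rewrite ?rmorph1.
  - by move=> [F1 _ <-] [F2 _ <-]; exists (F1 - F2); rewrite ?rmorphB.
  - by move=> [F1 _ <-] [F2 _ <-]; exists (F1 * F2); rewrite ?rmorphM.
move=> [[c _ <-]|[->|->]].
- by exists c%:P%:P; rewrite ?evalC ?evalxC.
- by exists 'X%:P; rewrite ?evalC ?evalxX.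
- by exists 'X; rewrite ?evalX.
Qed.

Lemma deriv_evalx p : D (evalx p) = evalx p^`() * D x.
Proof.
elim/poly_ind: p => [|p c IHp].
  by rewrite derivC rmorph0 mul0r (derivation0 D_der).
rewrite derivD derivM derivX derivC addr0 mulr1.
rewrite !rmorphD !rmorphM /= evalxC evalxX.
rewrite (derivation_add D_der) (derivation_mul D_der) deriv_iota IHp; ring.
Qed.

Lemma deriv_eval a b F : eval a = D x -> eval b = D y ->
  D (eval F) = eval (planar_deriv a b F).
Proof.
move=> a_eq b_eq; have [pD pM] := planar_derivP a b.
elim/poly_ind: F => [|F p IHF].
  by rewrite (derivation0 (planar_derivP a b)) rmorph0 (derivation0 D_der).
rewrite pD pM planar_derivX planar_derivC.
rewrite !rmorphD !rmorphM /= !evalC evalX (derivation_add D_der).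
by rewrite (derivation_mul D_der) IHF deriv_evalx a_eq b_eq [D x * _]mulrC.
Qed.

Hypothesis Dx_neq0 : D x != 0.

(** Differentiating an element p(x) of J gives p'(x) D x, from which D x can be
    cancelled: the degree drops until a nonzero constant of C is reached. *)
Lemma meets_base_unit (J : set A) p : is_diff_ideal D setT J ->
  saturated (D x) J -> p != 0 -> J (evalx p) -> J 1.
Proof.
move=> J_ideal J_sat; have [n] := ubnP (size p).
elim: n p => // n IHn p le_pn p0 Jp.
have [p_gt1|p_le1] := ltnP 1 (size p).
  apply: (IHn p^`()); last 1 first.
  - apply: J_sat; rewrite mulrC -deriv_evalx.
    exact: (diff_ideal_der J_ideal).
  - exact: leq_trans (lt_size_deriv p0) le_pn.
  - exact: deriv_neq0.
have /size_poly1P[c c0 p_eq] : size p == 1%N.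
  by move: p0 p_le1; rewrite -size_poly_gt0; lia.
have -> : 1 = iota c^-1 * evalx p.
  by rewrite p_eq evalxC -rmorphM mulVf // rmorph1.
exact: (diff_ideal_mul J_ideal).
Qed.

(** A relation p(x) = 0 would make the zero ideal contain 1. *)
Lemma evalx_neq0 p : p != 0 -> evalx p != 0.
Proof.
move=> p0; apply/eqP => xp0.
have zero_ideal : is_diff_ideal D setT [set 0].
  apply: full_diff_idealP => //= [a b -> ->|t a ->|a ->].
  - by rewrite subr0.
  - by rewrite mulr0.
  - exact: derivation0.
have zero_sat : saturated (D x) [set 0].
  by move=> a /eqP; rewrite mulf_eq0 (negPf Dx_neq0) => /eqP.
have := meets_base_unit zero_ideal zero_sat p0 xp0.
by move/eqP; rewrite oner_eq0.
Qed.

(** Let M be a polynomial of least degree in y that vanishes in A, and f one of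
    least degree in y whose value is nonzero and lies in J.  Pseudo-division of
    the one of larger degree by the other gives a quotient or a remainder that
    contradicts one of the two choices, unless f does not involve y. *)
Lemma meets_base (J : set A) (F : {poly {poly C}}) :
  is_diff_ideal D setT J -> F != 0 -> eval F = 0 ->
  (exists2 h, J h & h != 0) -> exists2 p, p != 0 & J (evalx p).
Proof.
move=> J_ideal F0 eF0 [h Jh h0].
have [{F0 eF0}M [M0 eM0] M_min] := @exists_min {poly {poly C}}
  [set F | F != 0 /\ eval F = 0] (fun F => size F) F (conj F0 eF0).
have [f0 h_eq] := eval_surj h; rewrite h_eq in Jh h0.
have [f [Jf ef0] f_min] := @exists_min {poly {poly C}}
  [set f | J (eval f) /\ eval f != 0] (fun f => size f) f0 (conj Jh h0).
have [f_gt1|f_le1] := ltnP 1 (size f); last first.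
  have f_eq := size1_polyC f_le1; rewrite f_eq evalC in Jf ef0.
  by exists f`_0 => //; apply: contraNneq ef0 => ->; rewrite rmorph0.
have [le_fM|lt_Mf] := leqP (size f) (size M).
  have eq_div := Pdiv.WeakIdomain.divp_eq M f.
  set c := lead_coef f ^+ _ in eq_div.
  have c0 : c != 0.
    rewrite expf_neq0 // lead_coef_eq0 -size_poly_gt0; exact: ltnW.
  have f0' : f != 0 by rewrite -size_poly_gt0 ltnW.
  have r_lt : (size (M %% f)%R < size f)%N by rewrite Pdiv.Idomain.ltn_modp.
  have e_eq : eval (M %/ f) * eval f + eval (M %% f) = 0.
    by rewrite -rmorphM -rmorphD -eq_div -mul_polyC rmorphM eM0 mulr0.
  have er0 : eval (M %% f) = 0.
    apply/eqP/negPn/negP => er0; suff : (size f <= size (M %% f)%R)%N by lia.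
    apply: f_min; split=> //.
    have -> : eval (M %% f) = 0 - eval (M %/ f) * eval f.
      by rewrite -e_eq [_ * _ + _]addrC addrK.
    apply: (diff_idealB J_ideal); first exact: (diff_ideal0 J_ideal).
    exact: (diff_ideal_mul J_ideal).
  have eq0 : eval (M %/ f) = 0.
    by move/eqP: e_eq; rewrite er0 addr0 mulf_eq0 (negPf ef0) orbF => /eqP.
  exfalso; have sz_q : size (M %/ f) = (size M - (size f).-1)%N.
    exact: Pdiv.Idomain.size_divp.
  have q0 : M %/ f != 0 by rewrite -size_poly_gt0 sz_q; lia.
  by have := M_min _ (conj q0 eq0); rewrite sz_q; lia.
have eq_div := Pdiv.WeakIdomain.divp_eq f M.
set c := lead_coef M ^+ _ in eq_div.
have c0 : c != 0 by rewrite expf_neq0 // lead_coef_eq0.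
have r_lt : (size (f %% M)%R < size M)%N by rewrite Pdiv.Idomain.ltn_modp.
have e_eq : eval (f %% M) = evalx c * eval f.
  have := congr1 eval eq_div; rewrite -mul_polyC rmorphD !rmorphM /= eM0 mulr0.
  by rewrite add0r evalC.
exfalso; suff : (size f <= size (f %% M)%R)%N by lia.
apply: f_min; rewrite /= e_eq; split; last by rewrite mulf_neq0 ?evalx_neq0.
exact: (diff_ideal_mul J_ideal).
Qed.

(** When y is algebraic over C(x), g = D x; otherwise g = D x * G, where every
    Darboux polynomial divides a power of G. *)
Lemma simple_denominator : exists2 g : A, g != 0 &
  forall J : set A, is_diff_ideal D setT J -> saturated g J ->
    (exists2 h, J h & h != 0) -> J 1.
Proof.
have [[F F0 eF0]|inj] := pselect (exists2 F, F != 0 & eval F = 0).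
  exists (D x) => // J J_ideal J_sat J_neq0.
  have [p p0 Jp] := meets_base J_ideal F0 eF0 J_neq0.
  exact: meets_base_unit Jp.
have eval_neq0 F : F != 0 -> eval F != 0.
  by move=> F0; apply/eqP => eF0; apply: inj; exists F.
have [a a_eq] := eval_surj (D x); have [b b_eq] := eval_surj (D y).
pose Dp := planar_deriv a b.
have DE F : D (eval F) = eval (Dp F) by exact: deriv_eval.
have [G G0 GP] : exists2 G : {poly {poly C}}, G != 0 &
    forall f l, f != 0 -> Dp f = l * f -> exists e r, f * r = G ^+ e.
  apply: darboux_finite => u w l u0 w0 Du Dw.
  have [|c uw_eq] := @wronskian_const (eval u) (eval w) (eval_neq0 w w0).
    by rewrite !DE /Dp Du Dw !rmorphM /=; ring.
  exists c; apply/eqP; rewrite -subr_eq0; apply/negPn/negP => /eval_neq0.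
  by rewrite rmorphB rmorphM /= evalC evalxC uw_eq subrr eqxx.
exists (D x * eval G); first by rewrite mulf_neq0 ?eval_neq0.
move=> J J_ideal J_sat [h Jh h0].
have Dx_sat := saturated_factor J_ideal J_sat.
have /(saturated_factor J_ideal) G_sat : saturated (eval G * D x) J.
  by rewrite mulrC.
(* The trace on A of the ideal generated by J in C(x)[y]. *)
pose J' : set {poly {poly C}} :=
  [set F | exists2 p, p != 0 & J (eval (p%:P * F))].
have JM t s : J s -> J (t * s) by exact: (diff_ideal_mul J_ideal).
have J'_ideal : is_diff_ideal Dp setT J'.
  apply: full_diff_idealP =>
    [|F1 F2 [p1 p1_0 J1] [p2 p2_0 J2]|H F [p p0 JF]|F [p p0 JF]].
  - exists 1; rewrite ?oner_neq0 // mulr0 rmorph0.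
    exact: (diff_ideal0 J_ideal).
  - exists (p1 * p2); first by rewrite mulf_neq0.
    have -> : eval ((p1 * p2)%:P * (F1 - F2)) =
        eval p2%:P * eval (p1%:P * F1) - eval p1%:P * eval (p2%:P * F2).
      by rewrite polyCM -!rmorphM -rmorphB; congr (eval _); ring.
    by apply: (diff_idealB J_ideal); apply: JM.
  - exists p => //; have -> : eval (p%:P * (H * F)) = eval H * eval (p%:P * F).
      by rewrite -rmorphM mulrCA.
    exact: JM.
  - exists (p ^+ 2); first by rewrite expf_neq0.
    (* Leibniz: p^2 (D F) = p D (p F) - (D p) (p F). *)
    have -> : eval ((p ^+ 2)%:P * Dp F) =
        eval p%:P * D (eval (p%:P * F)) - eval (Dp p%:P) * eval (p%:P * F).
      rewrite DE /Dp -!rmorphM -rmorphB (derivation_mul (planar_derivP a b)).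
      by congr (eval _); rewrite polyC_exp; ring.
    apply: (diff_idealB J_ideal); apply: JM => //.
    exact: (diff_ideal_der J_ideal).
have J'_sat p : p != 0 -> saturated p%:P J'.
  move=> p0 F [q q0 Jq]; exists (q * p); first by rewrite mulf_neq0.
  by rewrite polyCM -mulrA.
have J'_neq0 : exists2 F, J' F & F != 0.
  have [F h_eq] := eval_surj h; exists F.
    by exists 1; rewrite ?oner_neq0 // mul1r -h_eq.
  by apply: contraNneq h0 => F0; rewrite h_eq F0 rmorph0.
have [f [l [f0 [p p0 Jpf] Df]]] := darboux_in_ideal J'_ideal J'_sat J'_neq0.
have [e [r fr]] := GP f l f0 Df.
apply: (meets_base_unit J_ideal Dx_sat p0); rewrite -evalC.
apply: (saturatedX (n := e) G_sat).
have -> : eval G ^+ e * eval p%:P = eval r * eval (p%:P * f).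
  by rewrite -rmorphXn -fr -!rmorphM; congr (eval _); ring.
exact: JM.
Qed.

End TwoGenerators.

Theorem theorem3 (C : fieldExtType rat) (A : idomainType)
    (iota : {rmorphism C -> A}) (x1 x2 : A) (D : A -> A)
    (A_gen : algebra_gen iota [set x1; x2] = setT)
    (D_der : is_derivation D)
    (E_const : constants (frac_deriv D) = range (fun c : C => (iota c)%:F)) :
  exists T : set {fraction A},
    fg_diff_extension D T /\
    forall I : set {fraction A}, is_diff_ideal (frac_deriv D) T I ->
      I = [set 0] \/ I = T.
Proof.
suff [g g0 simple] : exists2 g : A, g != 0 &
    forall J : set A, is_diff_ideal D setT J -> saturated g J ->
      (exists2 h, J h & h != 0) -> J 1.
  exists (localization g); split; first exact: localization_extension.
  exact: localization_simple.
have [Dx1|Dx1] := eqVneq (D x1) 0; last exact: simple_denominator A_gen _ _ Dx1.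
have [Dx2|Dx2] := eqVneq (D x2) 0; last first.
  by rewrite setUC in A_gen; apply: simple_denominator A_gen _ _ Dx2.
have D_eq0 t : D t = 0.
  have [F ->] := eval_surj A_gen t.
  rewrite (@deriv_eval _ _ _ _ _ _ D_der E_const 0 0) ?rmorph0 //.
  by rewrite /planar_deriv !mul0r addr0 rmorph0.
exists 1 => [|J J_ideal _ [h Jh h0]]; first exact: oner_neq0.
have [|c one_eq] := wronskian_const D_der E_const (u := 1) h0.
  by rewrite !D_eq0; ring.
by rewrite one_eq; apply: (diff_ideal_mul J_ideal).
Qed.
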